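(* For any connected graph $G$, $pd_s(G)\le \alpha(G_{SR})+1$.
   Context: All graphs are finite, simple and connected; $d_G$ is the shortest-path distance and $d_G(x,W)=\min\{d_G(x,w):w\in W\}$. A set $W$ of vertices strongly resolves two different vertices $x,y\notin W$ if $d_G(x,W)=d_G(x,y)+d_G(y,W)$ or $d_G(y,W)=d_G(y,x)+d_G(x,W)$. An ordered vertex partition $\Pi$ of $G$ is a strong resolving partition if every two different vertices in the same set of $\Pi$ are strongly resolved by some set of $\Pi$; $pd_s(G)$ is the minimum cardinality of a strong resolving partition. A vertex $u$ is maximally distant from $v$ if $d_G(v,w)\le d_G(u,v)$ for every neighbor $w$ of $u$; $u,v$ are mutually maximally distant if each is maximally distant from the other. The boundary $\partial(G)$ is the set of vertices $u$ for which some $v$ exists with $u,v$ mutually maximally distant. The strong resolving graph $G_{SR}$ has vertex set $\partial(G)$, two vertices being adjacent iff they are mutually maximally distant in $G$. $\alpha(H)$ denotes the vertex cover number of a graph $H$. *)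

(* Defs.v *)
From mathcomp Require Import all_boot.

Set Implicit Arguments.
Unset Strict Implicit.
Unset Printing Implicit Defensive.

Record sgraph := SGraph {
  vertex :> finType;
  adj : rel vertex;
  adj_sym : symmetric adj;
  adj_irr : irreflexive adj }.

Definition connected_graph (G : sgraph) : Prop :=
  forall x y : G, connect (@adj G) x y.

Section Distance.
Variable G : sgraph.
Implicit Types (x y u v : G) (W C : {set G}).

Definition has_walk x y (k : nat) : bool :=
  [exists p : k.-tuple G, path (@adj G) x p && (last x p == y)].

(* A shortest path has fewer than #|G| edges, so this is the least length of a
   walk from x to y; it is #|G| exactly when there is none. *)
Definition dist x y : nat := find (has_walk x y) (iota 0 #|G|).

(* As dist never exceeds #|G|, the default value only matters for W = set0. *)
Definition dist_set x W : nat := \big[minn/#|G|]_(w in W) dist x w.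

Definition strongly_resolves W x y : bool :=
  [&& x != y, x \notin W, y \notin W &
      (dist_set x W == dist x y + dist_set y W)
      || (dist_set y W == dist y x + dist_set x W)].

Definition ordered_partition (Pi : seq {set G}) : bool :=
  uniq Pi && partition [set W in Pi] [set: G].

Definition strong_resolving_partition (Pi : seq {set G}) : bool :=
  ordered_partition Pi &&
  [forall X : {set G} in Pi, forall x in X, forall y in X,
     (x != y) ==> [exists W : {set G} in Pi, strongly_resolves W x y]].

Lemma strong_resolving_partition_exists :
  exists k, [exists Pi : k.-tuple {set G}, strong_resolving_partition Pi].
Proof.
pose s := [seq [set x] | x <- enum G].
exists (size s); apply/existsP; exists (in_tuple s).
rewrite /strong_resolving_partition /ordered_partition /=.
rewrite map_inj_uniq ?enum_uniq //=; last exact: set1_inj.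
have -> : [set W in s] = [set [set x] | x in [set: G]].
  apply/setP => W; rewrite inE; apply/mapP/imsetP => -[x _ ->];
  by exists x; rewrite ?mem_enum ?inE.
apply/andP; split.
  apply/and3P; split.
  - rewrite cover_imset; apply/eqP/setP => x; rewrite inE.
    by apply/bigcupP; exists x; rewrite ?inE.
  - apply/trivIsetP => _ _ /imsetP[x _ ->] /imsetP[y _ ->] xy.
    by rewrite disjoints1 inE; apply: contraNneq xy => ->.
  - by apply/imsetP => -[x _ /setP/(_ x)]; rewrite !inE eqxx.
apply/forall_inP => _ /mapP[z _ ->].
apply/forall_inP => x; rewrite inE => /eqP ->.
by apply/forall_inP => y; rewrite inE => /eqP ->; rewrite eqxx.
Qed.

Definition pd_s : nat := ex_minn strong_resolving_partition_exists.

Definition maximally_distant u v : bool :=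
  [forall w, adj u w ==> (dist v w <= dist u v)].

Definition mutually_maximally_distant u v : bool :=
  maximally_distant u v && maximally_distant v u.

Definition boundary : {set G} :=
  [set u | [exists v, mutually_maximally_distant u v]].

Definition vertex_cover C : bool :=
  [forall x, forall y, adj x y ==> (x \in C) || (y \in C)].

Definition alpha : nat := #|[arg min_(C < setT | vertex_cover C) #|C|]|.

End Distance.

Section StrongResolvingGraph.
Variable G : sgraph.

(* The condition u != v only matters when G has a single vertex, which is then
   vacuously mutually maximally distant from itself. *)
Definition sr_adj (u v : {x : G | x \in boundary G}) : bool :=
  (u != v) && mutually_maximally_distant (val u) (val v).

Lemma sr_adj_sym : symmetric sr_adj.
Proof.
by move=> u v; rewrite /sr_adj eq_sym /mutually_maximally_distant
  [maximally_distant (val v) _ && _]andbC.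
Qed.

Lemma sr_adj_irr : irreflexive sr_adj.
Proof. by move=> u; rewrite /sr_adj eqxx. Qed.

Definition strong_resolving_graph : sgraph := SGraph sr_adj_sym sr_adj_irr.

End StrongResolvingGraph.

(* Main.v *)
Require Import Defs.
From mathcomp Require Import all_boot.
From mathcomp Require Import zify.

(** Let [S] be a minimum vertex cover of the strong resolving graph, and take
the partition into the singletons of [S] and the complement of [S].  A geodesic
between two vertices [x], [y] outside [S], extended to a geodesic from [u] to
[v] through [x] and [y] that is as long as possible, has mutually maximally
distant ends; hence one of [u], [v] lies in [S], and its singleton strongly
resolves [x] and [y]. *)

Section Distance.
Variable G : sgraph.
Implicit Types x y z u v w : G.

Lemma has_walkP x y k :
  reflect (exists p, [/\ path (@adj G) x p, last x p = y & size p = k])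
          (has_walk x y k).
Proof.
apply: (iffP existsP) => [[p /andP[pth /eqP lst]] | [p [pth lst sz]]].
  by exists p; rewrite size_tuple.
by move/eqP: sz => sz; exists (Tuple sz); rewrite /= pth lst eqxx.
Qed.

Lemma dist_le_card x y : dist x y <= #|G|.
Proof. by rewrite -[X in _ <= X](size_iota 0) find_size. Qed.

Lemma dist_le_walk x y k : has_walk x y k -> dist x y <= k.
Proof.
(* A walk with at least [#|G|] edges gives no contradiction with the search, whose range stops
   there; the cap on [dist] settles it. *)
move=> walk; have [ltk | lek] := ltnP k #|G|; last first.
  exact: leq_trans (dist_le_card x y) lek.
rewrite leqNgt; apply/negP => /(before_find 0).
by rewrite nth_iota // add0n walk.
Qed.

Lemma has_walk_dist x y : connect (@adj G) x y -> has_walk x y (dist x y).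
Proof.
(* A walk without repeated vertices has fewer than [#|G|] edges, so its length lies in the range
   searched by [dist]. *)
move=> /connectP[p0 pth0 ->]; case/shortenP: pth0 => p pth uniq_p _.
have szp : size p < #|G|.
  by rewrite -[(size p).+1]/(size (x :: p)) -(card_uniqP uniq_p) max_card.
have has_w : has (has_walk x (last x p)) (iota 0 #|G|).
  apply/hasP; exists (size p); first by rewrite mem_iota.
  by apply/has_walkP; exists p.
have := nth_find 0 has_w.
by rewrite nth_iota // -[X in _ < X](size_iota 0) -has_find.
Qed.

Lemma distxx x : dist x x = 0.
Proof.
by apply/eqP; rewrite -leqn0 dist_le_walk //; apply/has_walkP; exists [::].
Qed.

Lemma dist_adj x y : adj x y -> dist x y <= 1.
Proof.
move=> xy; apply/dist_le_walk/has_walkP; exists [:: y].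
by rewrite /= xy.
Qed.

(** The default value [#|G|] of the minimum is absorbed because it bounds every distance. *)
Lemma dist_set1 x u : dist_set x [set u] = dist x u.
Proof. by rewrite /dist_set big_set1E; apply/minn_idPl/dist_le_card. Qed.

Hypothesis conn : connected_graph G.

Lemma dist_triangle x y z : dist x z <= dist x y + dist y z.
Proof.
have /has_walkP[p [pth lst <-]] := has_walk_dist _ _ (conn x y).
have /has_walkP[q [qth qst <-]] := has_walk_dist _ _ (conn y z).
apply/dist_le_walk/has_walkP; exists (p ++ q).
by rewrite cat_path last_cat lst pth qth size_cat.
Qed.

Lemma dist_sym x y : dist x y = dist y x.
Proof.
wlog suff le_sym : x y / dist x y <= dist y x.
  by apply/eqP; rewrite eqn_leq !le_sym.
have /has_walkP[p [pth lst <-]] := has_walk_dist _ _ (conn y x).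
(* Reversing [y :: p] puts its last vertex [x] in front; what follows is [rev (belast y p)]. *)
apply/dist_le_walk/has_walkP; exists (rev (belast y p)).
rewrite size_rev size_belast -{1}lst rev_path; split=> //.
  by rewrite (eq_path (e' := @adj G)) // => a b; rewrite adj_sym.
by case: p pth lst => [|a p] //= _ _; rewrite rev_cons last_rcons.
Qed.

Lemma geodesic_extension x y :
  exists u v, dist u v = dist u x + dist x y + dist y v
              /\ mutually_maximally_distant u v.
Proof.
pose ext (c : G * G) :=
  dist c.1 c.2 == dist c.1 x + dist x y + dist y c.2.
have ext0 : ext (x, y) by rewrite /ext /= !distxx addn0.
have [[u v] /= /eqP /= ext_uv max_uv] :=
  @arg_maxnP _ (x, y) ext (fun c => dist c.1 c.2) ext0.
exists u, v; split=> //; apply/andP; split; apply/forall_inP => w adj_w.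
  (* Replacing [u] by its neighbor [w] adds at most 1 to the distance to [x]. If [w] is farther than
     [u] from [v], the triangle inequalities become equalities, so [(w, v)] is a longer
     extension. *)
  rewrite leqNgt; apply/negP => lt_w.
  have := dist_adj _ _ adj_w; have := dist_triangle w u x.
  have := dist_triangle w x v; have := dist_triangle x y v.
  rewrite (dist_sym w u) => le1 le2 le3 le4.
  have /max_uv /= : ext (w, v).
    by apply/eqP => /=; move: lt_w; rewrite (dist_sym v w); lia.
  by move: lt_w; rewrite (dist_sym v w); lia.
rewrite leqNgt; apply/negP => lt_w.
have := dist_adj _ _ adj_w; have := dist_triangle y v w.
have := dist_triangle u x w; have := dist_triangle x y w.
move: lt_w; rewrite (dist_sym v u) => lt_w le1 le2 le3 le4.
have /max_uv /= : ext (u, w) by apply/eqP => /=; lia.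
by lia.
Qed.

End Distance.

(** Resolution does not depend on the order of the blocks, so any enumeration of [P] will do. *)
Lemma pd_s_le (G : sgraph) (P : {set {set G}}) :
    partition P [set: G] ->
    (forall X x y, X \in P -> x \in X -> y \in X -> x != y ->
       exists2 W, W \in P & strongly_resolves W x y) ->
  pd_s G <= #|P|.
Proof.
move=> partP resP; rewrite /pd_s; case: ex_minnP => m _ -> //.
rewrite cardE; apply/existsP; exists (in_tuple (enum P)).
rewrite /strong_resolving_partition /ordered_partition /= enum_uniq.
rewrite set_enum partP /=.
apply/forall_inP => X; rewrite mem_enum => XP.
apply/forall_inP => x xX; apply/forall_inP => y yX; apply/implyP => xy.
have [W WP res] := resP X x y XP xX yX xy.
by apply/existsP; exists W; rewrite mem_enum WP.
Qed.

Lemma pd_s_le_resolving_singletons (G : sgraph) (S : {set G}) :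
    (forall x y, x \notin S -> y \notin S -> x != y ->
       exists2 u, u \in S & strongly_resolves [set u] x y) ->
  pd_s G <= #|S| + 1.
Proof.
(* The fibers of [f] are the singletons of [S] and the complement of [S]; taking fibers leaves out
   the complement when it is empty. *)
move=> resS; pose f x := if x \in S then Some x else None.
pose P := preim_partition f [set: G].
have leP : #|P| <= #|S| + 1.
  have -> : P = (fun o => [set y in [set: G] | o == f y]) @: (f @: [set: G]).
    by rewrite -imset_comp.
  apply: leq_trans (leq_imset_card _ _) _.
  have sub : f @: [set: G] \subset None |: Some @: S.
    apply/subsetP => _ /imsetP[x _ ->]; rewrite !inE /f.
    by case: ifP => // xS; rewrite imset_f.
  apply: leq_trans (subset_leq_card sub) _.
  by rewrite cardsU1 addnC leq_add ?leq_imset_card ?leq_b1.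
apply: leq_trans leP; apply: pd_s_le; first exact: preim_partitionP.
move=> _ x y /imsetP[z _ ->]; rewrite !inE /= => /eqP fx /eqP fy xy.
have fxy : f x = f y by rewrite -fx.
(* [Some] is injective, so different vertices with equal labels are both labelled [None]. *)
have [xS yS] : x \notin S /\ y \notin S.
  move: fxy; rewrite /f; case: ifP; case: ifP => // _ _ [exy].
  by rewrite exy eqxx in xy.
have [u uS res] := resS x y xS yS xy.
exists [set u] => //; apply/imsetP; exists u => //.
apply/setP => w; rewrite !inE /f uS eq_sym /=.
case: ifP => [_ | wS] //; apply/eqP => uw; by rewrite -uw uS in wS.
Qed.

Lemma alpha_cover (H : sgraph) :
  exists2 C : {set H}, vertex_cover C & #|C| = alpha H.
Proof.
rewrite /alpha; case: arg_minnP => [|C covC _]; last by exists C.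
by apply/forallP => x; apply/forall_inP => y _; rewrite inE.
Qed.

Theorem theorem4 (G : sgraph) (hG : connected_graph G) :
  pd_s G <= alpha (strong_resolving_graph G) + 1.
Proof.
have [C covC <-] := alpha_cover (strong_resolving_graph G).
have <- : #|[set val u | u in C]| = #|C| by apply/card_imset/val_inj.
apply: pd_s_le_resolving_singletons => x y xS yS xy.
have [u [v [uv_ext mmd_uv]]] := geodesic_extension _ hG x y.
have mmd_vu : mutually_maximally_distant v u.
  by rewrite /mutually_maximally_distant andbC.
have dist_xy : 0 < dist x y.
  rewrite lt0n; apply: contraNneq xy => dist0.
  have /has_walkP[p [_ lst szp]] := has_walk_dist _ _ _ (hG x y).
  by move: lst szp; rewrite dist0 => <- /size0nil->.
(* [sr_adj] demands different ends; here the extended geodesic is at least as long as the one from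
   [x] to [y]. *)
have uv : u != v.
  by apply/eqP => euv; move: uv_ext dist_xy; rewrite euv distxx; lia.
have uB : u \in boundary G by rewrite inE; apply/existsP; exists v.
have vB : v \in boundary G by rewrite inE; apply/existsP; exists u.
have := covC => /forallP/(_ (Sub u uB))/forall_inP/(_ (Sub v vB)).
have -> : @adj (strong_resolving_graph G) (Sub u uB) (Sub v vB).
  by rewrite /= /sr_adj /= mmd_uv andbT -(inj_eq val_inj) /=.
(* Together with [uv_ext], these force [dist u y = dist u x + dist x y] and
   [dist x v = dist x y + dist y v]: the end [u] resolves by the second alternative, [v] by the
   first. *)
have le_uv := dist_triangle _ hG u x v.
have le_uy := dist_triangle _ hG u x y.
have le_yv := dist_triangle _ hG u y v.
have le_xv := dist_triangle _ hG x y v.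
have notin1 z w : z \notin [set val c | c in C] ->
    w \in [set val c | c in C] -> z \notin [set w].
  by move=> zS wS; rewrite inE; apply: contraNneq zS => ->.
case/(_ isT)/orP => [uC | vC].
  have uS : u \in [set val c | c in C] by apply/imsetP; exists (Sub u uB).
  exists u => //; rewrite /strongly_resolves xy !(notin1 _ u) //= !dist_set1.
  by apply/orP; right; rewrite !(dist_sym _ hG _ u) (dist_sym _ hG y x); lia.
have vS : v \in [set val c | c in C] by apply/imsetP; exists (Sub v vB).
exists v => //; rewrite /strongly_resolves xy !(notin1 _ v) //= !dist_set1.
by apply/orP; left; lia.
Qed.
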